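(* Let $\mathcal A$ be a complex subspace arrangement whose intersection lattice $\mathcal L$ is a geometric lattice, and let $(D_{\mathcal A},d)$ be its relative atomic differential graded algebra over $\mathbb Q$. The linear map $$\Psi:\ D_{\mathcal A}\longrightarrow H^*(D_{\mathcal A},d),\qquad \sigma\longmapsto\begin{cases}[\sigma], & \text{if }\sigma\text{ is independent},\\ 0, & \text{otherwise},\end{cases}$$ defined on the basis of all subsets $\sigma$ of the set of atoms of $\mathcal L$, is a quasi-isomorphism of differential graded algebras, where $H^*(D_{\mathcal A},d)$ carries the zero differential. In particular, $D_{\mathcal A}$ is formal.
   Context: $\mathcal A$ is a finite arrangement of proper linear subspaces of a finite-dimensional complex vector space $V$, none of which contains another. Its intersection lattice $\mathcal L$ is the set of all intersections of subfamilies of $\mathcal A$ (the empty intersection being $V=\hat 0$), ordered by reverse inclusion. Its set of atoms $\mathfrak A(\mathcal L)$ is in bijection with $\mathcal A$; a linear order on $\mathfrak A(\mathcal L)$ is fixed. For $A\in\mathcal L$, $\mathrm{cd}\,A$ denotes the complex codimension of $A$ in $V$ (which need not be the rank of $A$ in $\mathcal L$). For $\sigma\subseteq\mathfrak A(\mathcal L)$, $\bigvee\sigma$ is the join in $\mathcal L$ (with $\bigvee\emptyset=\hat 0$). The relative atomic d.g.a. $D_{\mathcal A}$ is the $\mathbb Q$-vector space with basis all subsets $\sigma\subseteq\mathfrak A(\mathcal L)$, graded by $\deg\sigma=2\,\mathrm{cd}\bigvee\sigma-|\sigma|$. For $\sigma=\{i_1<\dots<i_k\}$ put $\sigma_j=\sigma\setminus\{i_j\}$;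 the differential is $$d\sigma=\sum_{j:\ \bigvee\sigma_j=\bigvee\sigma}(-1)^j\sigma_j .$$ The product is $$\sigma\cdot\tau=\begin{cases}(-1)^{\mathrm{sgn}\,\epsilon(\sigma,\tau)}\,\sigma\cup\tau & \text{if }\mathrm{cd}\bigvee\sigma+\mathrm{cd}\bigvee\tau=\mathrm{cd}\bigvee(\sigma\cup\tau),\\ 0&\text{otherwise},\end{cases}$$ where $\epsilon(\sigma,\tau)$ is the permutation that, applied to $\sigma\cup\tau$ in the induced linear order, places the elements of $\tau$ after the elements of $\sigma$, both in the induced linear order, and $\mathrm{sgn}\in\{0,1\}$ denotes its parity. It is known that this is a differential graded algebra. A subset $\sigma\subseteq\mathfrak A(\mathcal L)$ is independent if $\bigvee(\sigma\setminus\{s\})<\bigvee\sigma$ for every $s\in\sigma$ (in a geometric lattice, equivalently, $\mathrm{rk}\bigvee\sigma=|\sigma|$); an independent $\sigma$ satisfies $d\sigma=0$, and $[\sigma]$ denotes its cohomology class. A quasi-isomorphism of d.g.a.'s is a d.g.a. morphism inducing an isomorphism in cohomology. A d.g.a. $E$ is formal if it is connected with $H^*(E)$ (with zero differential) by a finite sequence of d.g.a.'s in which each neighboring pair is connected by a quasi-isomorphism in at least one direction. *)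

(* Defs.v *)
From HB Require Import structures.
From mathcomp Require Import all_boot all_order all_algebra all_fingroup.
From mathcomp Require Import generic_quotient boolp reals complex ring zify.

Set Implicit Arguments.
Unset Strict Implicit.
Unset Printing Implicit Defensive.

Import Order.TTheory GRing.Theory Num.Theory.
Local Open Scope ring_scope.

Section GeometricLattice.
Local Open Scope order_scope.
Variables (disp : Order.disp_t) (L : finTBLatticeType disp).

Definition covers (x y : L) : bool :=
  (x < y) && [forall z : L, ~~ ((x < z) && (z < y))].

Definition is_atom (a : L) : bool := covers \bot a.

Definition atomistic : Prop :=
  forall x : L, x = \join_(a : L | is_atom a && (a <= x)) a.

Definition semimodular : Prop :=
  forall x y : L, covers (x `&` y) x -> covers y (x `|` y).

Definition geometric_lattice : Prop := atomistic /\ semimodular.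

End GeometricLattice.
Arguments geometric_lattice {disp} L.

(* The subspaces are enumerated without repetition by 'I_n. As they are the
   atoms of the intersection lattice (is_atomP, atom_inj below), sets of atoms
   are represented by {set 'I_n}, and the order of 'I_n is the chosen linear
   order on the atoms. *)
Record arrangement (K : fieldType) (V : vectType K) (n : nat) := Arrangement {
  subspace :> 'I_n -> {vspace V};
  subspace_proper : forall i, subspace i != fullv;
  subspace_antichain : forall i j, (subspace i <= subspace j)%VS -> i = j
}.

Section IntersectionLattice.
Variables (K : fieldType) (V : vectType K) (n : nat) (A : arrangement V n).

Definition intersection (S : {set 'I_n}) : {vspace V} :=
  (\bigcap_(i in S) A i)%VS.

Definition intersection_lattice : Type := seq_sub (codom intersection).

HB.instance Definition _ := Finite.on intersection_lattice.
HB.instance Definition _ := SubType.on intersection_lattice.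

Implicit Types x y z : intersection_lattice.

Definition flat (S : {set 'I_n}) : intersection_lattice :=
  SeqSub (codom_f intersection S).

Lemma flatP x : exists S, x = flat S.
Proof.
by case/codomP: (ssvalP x) => S xS; exists S; apply/val_inj.
Qed.

Definition il_le : rel intersection_lattice :=
  fun x y => (ssval y <= ssval x)%VS.

Lemma il_le_refl : reflexive il_le. Proof. by move=> x; apply: subvv. Qed.
Lemma il_le_anti : antisymmetric il_le.
Proof. by move=> x y H; apply/val_inj/eqP; rewrite eqEsubv andbC. Qed.
Lemma il_le_trans : transitive il_le.
Proof. by move=> y x z H1 H2; apply: subv_trans H2 H1. Qed.

Fact il_display : Order.disp_t. Proof. exact: (Order.Disp tt tt). Qed.

HB.instance Definition _ := Order.Le_isPOrder.Build il_display
  intersection_lattice il_le_refl il_le_anti il_le_trans.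

Lemma leEil x y : (x <= y)%O = (ssval y <= ssval x)%VS. Proof. by []. Qed.

Lemma sub_intersectionP (U : {vspace V}) (S : {set 'I_n}) :
  reflect (forall i, i \in S -> (U <= A i)%VS) (U <= intersection S)%VS.
Proof. exact: subv_bigcapP. Qed.

Definition il_supp (U : {vspace V}) := [set i | (U <= A i)%VS].
Definition il_join x y := flat (il_supp (ssval x) :|: il_supp (ssval y)).
Definition il_meet x y := flat (il_supp (ssval x) :&: il_supp (ssval y)).

Lemma intersection_supp x : intersection (il_supp (ssval x)) = ssval x.
Proof.
have [S ->] := flatP x; apply/eqP; rewrite eqEsubv /=; apply/andP; split.
  by apply/sub_intersectionP => i iS; apply: bigcapv_inf (subvv _); rewrite inE;
     apply: bigcapv_inf (subvv _).
by apply/sub_intersectionP => i; rewrite inE.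
Qed.

Lemma il_joinE x y : ssval (il_join x y) = (ssval x :&: ssval y)%VS.
Proof.
rewrite -[in RHS](intersection_supp x) -[in RHS](intersection_supp y).
apply/eqP; rewrite eqEsubv subv_cap -andbA; apply/and3P; split.
- by apply/sub_intersectionP => i ix; apply: bigcapv_inf (subvv _); rewrite inE ix.
- by apply/sub_intersectionP => i ix; apply: bigcapv_inf (subvv _); rewrite inE ix orbT.
apply/sub_intersectionP => i; rewrite inE => /orP[] iS.
  by apply: subv_trans (capvSl _ _) _; apply: bigcapv_inf (subvv _).
by apply: subv_trans (capvSr _ _) _; apply: bigcapv_inf (subvv _).
Qed.

Lemma il_meetP x y z : (x <= il_meet y z)%O = (x <= y)%O && (x <= z)%O.
Proof.
rewrite !leEil -{1 2 3}(intersection_supp x); apply/sub_intersectionP/andP => [H|].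
  split; apply/sub_intersectionP => i /H /=; apply: subv_trans;
  by apply/sub_intersectionP => j; rewrite !inE => /andP[].
move=> [/sub_intersectionP Hy /sub_intersectionP Hz] i iS.
by apply: bigcapv_inf (subvv _); rewrite !inE Hy ?Hz.
Qed.

Lemma il_joinP x y z : (il_join x y <= z)%O = (x <= z)%O && (y <= z)%O.
Proof. by rewrite !leEil il_joinE subv_cap. Qed.

HB.instance Definition _ := Order.POrder_MeetJoin_isLattice.Build il_display
  intersection_lattice il_meetP il_joinP.

Lemma il_le0x x : (flat set0 <= x)%O.
Proof. by rewrite leEil /= /intersection big_set0 subvf. Qed.

Lemma il_lex1 x : (x <= flat setT)%O.
Proof.
rewrite leEil -(intersection_supp x); apply/sub_intersectionP => i _.
exact: bigcapv_inf (subvv _).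
Qed.

HB.instance Definition _ := Order.hasBottom.Build il_display
  intersection_lattice il_le0x.
HB.instance Definition _ := Order.hasTop.Build il_display
  intersection_lattice il_lex1.

Definition atom (i : 'I_n) : intersection_lattice := flat [set i].

Definition vee (s : {set 'I_n}) : intersection_lattice :=
  (\join_(i in s) atom i)%O.

Definition cd x : nat := (\dim {:V} - \dim (ssval x))%N.

Lemma atomE i : ssval (atom i) = A i.
Proof. by rewrite /= /intersection big_set1. Qed.

Lemma veeE s : vee s = flat s.
Proof.
apply/val_inj; rewrite /= /vee /intersection.
under [RHS]eq_bigr do rewrite -atomE.
by elim/big_rec2: _ => [|i x y _ <-]; rewrite ?il_joinE //= /intersection big_set0.
Qed.

Lemma is_atomP x : reflect (exists i, x = atom i) (is_atom x).
Proof.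
have atom_gt0 i : (\bot < atom i)%O.
  rewrite lt0x; apply: contraNneq (subspace_proper A i) => /(congr1 (@ssval _ _)).
  by rewrite atomE => ->; rewrite /= /intersection big_set0.
have ge_atom y : (\bot < y)%O -> exists i, (atom i <= y)%O.
  have [S ->] := flatP y; have [->|[i iS] _] := set_0Vmem S.
    by rewrite ltxx.
  by exists i; rewrite leEil atomE; apply: bigcapv_inf (subvv _).
apply: (iffP andP) => [[x0 /forallP xP]|[i ->]].
  have [i ix] := ge_atom x x0; exists i; apply/eqP; rewrite eq_sym.
  by have := xP (atom i); rewrite atom_gt0 /= lt_neqAle ix andbT negbK.
split=> //; apply/forallP => z; apply/negP => /andP[/ge_atom[j jz] zi].
have /ltW := le_lt_trans jz zi; rewrite leEil !atomE => /subspace_antichain ij.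
by have := le_lt_trans jz zi; rewrite ij ltxx.
Qed.

Lemma atom_inj : injective atom.
Proof.
move=> i j /(congr1 (fun x => ssval x)); rewrite !atomE => e.
by apply: (@subspace_antichain _ _ _ A); rewrite e.
Qed.

End IntersectionLattice.

(* M is the internal direct sum of the subspaces gr k, k : int. *)
Definition is_grading (M : lmodType rat) (gr : int -> M -> Prop) : Prop :=
  [/\ forall k, gr k 0,
      forall k a x y, gr k x -> gr k y -> gr k (a *: x + y),
      forall x, exists s f,
        [/\ uniq s, forall k, gr k (f k) & x = \sum_(k <- s) f k]
    & forall s f, uniq s -> (forall k, gr k (f k)) -> \sum_(k <- s) f k = 0 ->
        forall k, k \in s -> f k = 0].

(* Associative unital algebras over rat, graded by int, with a differential of
   degree 1. The ring structures of MathComp's algType are not used because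
   they impose 1 != 0, which can fail in the cohomology of a d.g.a. *)
Record dga := DGA {
  dga_sort :> lmodType rat;
  dga_one : dga_sort;
  dga_mul : dga_sort -> dga_sort -> dga_sort;
  dga_d : dga_sort -> dga_sort;
  dga_gr : int -> dga_sort -> Prop;
  dga_mulA : associative dga_mul;
  dga_mul1 : left_id dga_one dga_mul;
  dga_mulr1 : right_id dga_one dga_mul;
  dga_mul_linearl : forall y, linear (dga_mul^~ y);
  dga_mul_linearr : forall x, linear (dga_mul x);
  dga_grading : is_grading dga_gr;
  dga_gr1 : dga_gr 0 dga_one;
  dga_grM : forall k l x y, dga_gr k x -> dga_gr l y ->
    dga_gr (k + l) (dga_mul x y);
  dga_d_linear : linear dga_d;
  dga_grd : forall k x, dga_gr k x -> dga_gr (k + 1) (dga_d x);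
  dga_dd : forall x, dga_d (dga_d x) = 0;
  dga_leibniz : forall k x y, dga_gr k x ->
    dga_d (dga_mul x y) =
      dga_mul (dga_d x) y + ((-1) ^ k : rat) *: dga_mul x (dga_d y)
}.

Section Cohomology.
Variable E : dga.
Local Notation d := (@dga_d E).
Local Notation gr := (@dga_gr E).
Local Notation mul := (@dga_mul E).
Implicit Types x y z w : E.

Lemma dga_dP a x y : d (a *: x + y) = a *: d x + d y.
Proof. exact: dga_d_linear. Qed.
HB.instance Definition _ := GRing.isLinear.Build rat E E *:%R d dga_dP.
Lemma dga_mullP y a : forall u v, mul (a *: u + v) y = a *: mul u y + mul v y.
Proof. exact: dga_mul_linearl. Qed.
Lemma dga_mulrP x a : forall u v, mul x (a *: u + v) = a *: mul x u + mul x v.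
Proof. exact: dga_mul_linearr. Qed.
Lemma dga_mul0l y : mul 0 y = 0.
Proof.
have := @dga_mullP y (-1) 0 0; by rewrite !scaleN1r !addNr.
Qed.
Lemma dga_mul0r x : mul x 0 = 0.
Proof.
have := @dga_mulrP x (-1) 0 0; by rewrite !scaleN1r !addNr.
Qed.
Lemma dga_mulDl x y z : mul (x + y) z = mul x z + mul y z.
Proof. by have := dga_mullP z 1 x y; rewrite !scale1r. Qed.
Lemma dga_mulDr x y z : mul x (y + z) = mul x y + mul x z.
Proof. by have := dga_mulrP x 1 y z; rewrite !scale1r. Qed.
Lemma dga_mulZl a x y : mul (a *: x) y = a *: mul x y.
Proof. by have := dga_mullP y a x 0; rewrite !addr0 dga_mul0l addr0. Qed.
Lemma dga_mulZr a x y : mul x (a *: y) = a *: mul x y.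
Proof. by have := dga_mulrP x a y 0; rewrite !addr0 dga_mul0r addr0. Qed.
Lemma dga_mulNl x y : mul (- x) y = - mul x y.
Proof. by rewrite -scaleN1r dga_mulZl scaleN1r. Qed.
Lemma dga_mulNr x y : mul x (- y) = - mul x y.
Proof. by rewrite -scaleN1r dga_mulZr scaleN1r. Qed.
Lemma dga_mul_suml (I : Type) (r : seq I) (P : pred I) F y :
  mul (\sum_(i <- r | P i) F i) y = \sum_(i <- r | P i) mul (F i) y.
Proof.
apply: (big_morph (mul^~ y)); last exact: dga_mul0l.
by move=> u v; rewrite dga_mulDl.
Qed.
Lemma dga_mul_sumr (I : Type) (r : seq I) (P : pred I) F x :
  mul x (\sum_(i <- r | P i) F i) = \sum_(i <- r | P i) mul x (F i).
Proof.
apply: (big_morph (mul x)); last exact: dga_mul0r.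
by move=> u v; rewrite dga_mulDr.
Qed.

Lemma gr0 k : gr k 0. Proof. by case: (dga_grading E). Qed.
Lemma grP k a x y : gr k x -> gr k y -> gr k (a *: x + y).
Proof. by case: (dga_grading E) => _ H _ _; apply: H. Qed.
Lemma grD k x y : gr k x -> gr k y -> gr k (x + y).
Proof. by move=> gx gy; rewrite -[x]scale1r; apply: grP. Qed.
Lemma grZ k a x : gr k x -> gr k (a *: x).
Proof. by move=> gx; rewrite -[_ *: _]addr0; apply: grP => //; apply: gr0. Qed.
Lemma grN k x : gr k x -> gr k (- x).
Proof. by rewrite -scaleN1r; apply: grZ. Qed.
Lemma gr_dec x : exists s f,
  [/\ uniq s, forall k, gr k (f k) & x = \sum_(k <- s) f k].
Proof. by case: (dga_grading E). Qed.
Lemma gr_indep s f : uniq s -> (forall k, gr k (f k)) ->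
  \sum_(k <- s) f k = 0 -> forall k, k \in s -> f k = 0.
Proof. by case: (dga_grading E) => _ _ _; apply. Qed.

Lemma dga_d1 : d (dga_one E) = 0.
Proof.
have := dga_leibniz (dga_one E) (dga_gr1 E).
rewrite dga_mul1 dga_mulr1 dga_mul1 expr0z scale1r => e.
by apply: (addrI (d (dga_one E))); rewrite -e addr0.
Qed.

Definition cocycle := {x : E | d x == 0}.

Lemma cocycle_d (x : cocycle) : d (val x) = 0.
Proof. exact/eqP/(valP x). Qed.

Definition cohomologous : rel cocycle :=
  fun u v => `[< exists w, val u - val v = d w >].

Lemma cohomologous_equiv : equiv_class_of cohomologous.
Proof.
split=> [x|x y|y x z].
- by apply/asboolP; exists 0; rewrite subrr linear0.
- by apply/asboolP/asboolP => -[w e]; exists (- w); rewrite linearN /= -e opprB.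
move=> /asboolP[w e] /asboolP[w' e']; apply/asboolP; exists (w + w').
by rewrite linearD /= -e -e' addrA subrK.
Qed.

Canonical cohomologous_equivRel := EquivRelPack cohomologous_equiv.

Definition cohomology : Type := {eq_quot cohomologous}%qT.
HB.instance Definition _ := Choice.on cohomology.
HB.instance Definition _ := EqQuotient.on cohomology.

Lemma cocycle0_subproof : d 0 == 0.
Proof. by rewrite linear0. Qed.
Definition cocycle0 : cocycle := exist _ (0 : E) cocycle0_subproof.

(* The cohomology class of x; the value is only meaningful when d x = 0. *)
Definition hclass x : cohomology := (\pi_cohomology (insubd cocycle0 x))%qT.
Definition hrepr (c : cohomology) : E := val (repr c).

Lemma hrepr_d c : d (hrepr c) = 0. Proof. exact: cocycle_d. Qed.
Lemma hreprK c : hclass (hrepr c) = c.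
Proof. by rewrite /hclass /hrepr valKd reprK. Qed.
Lemma hclassP x y : d x = 0 -> d y = 0 ->
  hclass x = hclass y <-> exists w, x - y = d w.
Proof.
move=> /eqP dx /eqP dy; rewrite -(insubdK cocycle0 dx) -(insubdK cocycle0 dy).
rewrite /hclass !valKd; split=> [/eqmodP/asboolP //|H].
by apply/eqmodP/asboolP.
Qed.
Lemma hrepr_hclass x : d x = 0 -> exists w, hrepr (hclass x) = x + d w.
Proof.
move=> dx; have [H _] := hclassP (hrepr_d (hclass x)) dx.
by have [w e] := H (hreprK _); exists w; rewrite -e addrC subrK.
Qed.
Lemma hclass_eq x y w : d y = 0 -> x = y + d w -> hclass x = hclass y.
Proof.
move=> dy ->; apply/hclassP => //; first by rewrite linearD /= dy dga_dd addr0.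
by exists w; rewrite addrAC subrr add0r.
Qed.
Lemma hclassW (P : cohomology -> Prop) :
  (forall x, d x = 0 -> P (hclass x)) -> forall c, P c.
Proof. by move=> H c; rewrite -(hreprK c); apply: H; apply: hrepr_d. Qed.

Definition hzero := hclass 0.
Definition hadd c c' := hclass (hrepr c + hrepr c').
Definition hopp c := hclass (- hrepr c).
Definition hscale (a : rat) c := hclass (a *: hrepr c).
Definition hmul c c' := hclass (mul (hrepr c) (hrepr c')).

Lemma dD0 x y : d x = 0 -> d y = 0 -> d (x + y) = 0.
Proof. by move=> dx dy; rewrite linearD /= dx dy addr0. Qed.
Lemma dN0 x : d x = 0 -> d (- x) = 0.
Proof. by move=> dx; rewrite linearN /= dx oppr0. Qed.
Lemma dZ0 a x : d x = 0 -> d (a *: x) = 0.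
Proof. by move=> dx; rewrite linearZ /= dx scaler0. Qed.

Lemma haddE x y : d x = 0 -> d y = 0 ->
  hadd (hclass x) (hclass y) = hclass (x + y).
Proof.
move=> dx dy; rewrite /hadd.
have [w ->] := hrepr_hclass dx; have [w' ->] := hrepr_hclass dy.
by apply: (@hclass_eq _ _ (w + w')); [apply: dD0|rewrite linearD addrACA].
Qed.
Lemma hoppE x : d x = 0 -> hopp (hclass x) = hclass (- x).
Proof.
move=> dx; rewrite /hopp; have [w ->] := hrepr_hclass dx.
by apply: (@hclass_eq _ _ (- w)); [apply: dN0|rewrite linearN opprD].
Qed.
Lemma hscaleE a x : d x = 0 -> hscale a (hclass x) = hclass (a *: x).
Proof.
move=> dx; rewrite /hscale; have [w ->] := hrepr_hclass dx.
by apply: (@hclass_eq _ _ (a *: w)); [apply: dZ0|rewrite linearZ scalerDr].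
Qed.

Fact haddA : associative hadd.
Proof.
elim/hclassW=> x dx; elim/hclassW=> y dy; elim/hclassW=> z dz.
by rewrite !haddE ?addrA //; apply: dD0.
Qed.
Fact haddC : commutative hadd.
Proof. by elim/hclassW=> x dx; elim/hclassW=> y dy; rewrite !haddE 1?addrC. Qed.
Fact hadd0 : left_id hzero hadd.
Proof. by elim/hclassW=> x dx; rewrite haddE ?add0r ?linear0. Qed.
Fact haddN : left_inverse hzero hopp hadd.
Proof.
by elim/hclassW=> x dx; rewrite hoppE ?haddE ?addNr //; apply: dN0.
Qed.
HB.instance Definition _ :=
  GRing.isZmodule.Build cohomology haddA haddC hadd0 haddN.

Lemma hclassD x y : d x = 0 -> d y = 0 -> hclass (x + y) = hclass x + hclass y.
Proof. by move=> dx dy; rewrite -haddE. Qed.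

Fact hscaleA a b c : hscale a (hscale b c) = hscale (a * b) c.
Proof.
by elim/hclassW: c => x dx; rewrite !hscaleE ?scalerA //; apply: dZ0.
Qed.
Fact hscale1 : left_id 1 hscale.
Proof. by elim/hclassW=> x dx; rewrite hscaleE ?scale1r. Qed.
Fact hscaleDr : right_distributive hscale +%R.
Proof.
move=> a; elim/hclassW=> x dx; elim/hclassW=> y dy.
rewrite -hclassD // !hscaleE ?scalerDr //; last exact: dD0.
by rewrite hclassD //; apply: dZ0.
Qed.
Fact hscaleDl c : {morph hscale^~ c : a b / a + b}.
Proof.
elim/hclassW: c => x dx a b; rewrite !hscaleE // scalerDl.
by rewrite hclassD //; apply: dZ0.
Qed.
HB.instance Definition _ := GRing.Zmodule_isLmodule.Build rat cohomology
  hscaleA hscale1 hscaleDr hscaleDl.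

Lemma hclass0 : hclass 0 = 0. Proof. by []. Qed.
Lemma hclassZ a x : d x = 0 -> hclass (a *: x) = a *: hclass x.
Proof. by move=> dx; rewrite -hscaleE. Qed.
Lemma hclass_sum (I : eqType) (r : seq I) (F : I -> E) :
    (forall i, i \in r -> d (F i) = 0) ->
  hclass (\sum_(i <- r) F i) = \sum_(i <- r) hclass (F i) /\
  d (\sum_(i <- r) F i) = 0.
Proof.
elim: r => [|i r IH] H; first by rewrite !big_nil linear0.
rewrite !big_cons; have [j jr|<- ds] := IH; first by apply: H; rewrite inE jr orbT.
have di : d (F i) = 0 by apply: H; rewrite mem_head.
by rewrite hclassD // dD0.
Qed.
Lemma hclass_eq0 x : d x = 0 -> hclass x = 0 <-> exists w, x = d w.
Proof.
move=> dx; rewrite -hclass0.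
by have := hclassP dx (linear0 _ : d 0 = 0); rewrite subr0.
Qed.

Lemma gr_decd x : d x = 0 -> exists s f,
  [/\ uniq s, forall k, gr k (f k), x = \sum_(k <- s) f k
    & forall k, k \in s -> d (f k) = 0].
Proof.
move=> dx; have [s [f [us gf xE]]] := gr_dec x; exists s, f; split=> // k ks.
have := @gr_indep [seq j + 1 | j <- s] (fun j => d (f (j - 1))).
move/(_ _ _ _ (k + 1)); rewrite addrK; apply.
- by rewrite map_inj_uniq //; apply: addIr.
- by move=> j; have := dga_grd (gf (j - 1)); rewrite subrK.
- rewrite big_map; under eq_bigr do rewrite addrK.
  by rewrite -linear_sum -xE.
by apply: map_f.
Qed.

Lemma dga_mul_d x w : d x = 0 -> exists w', mul x (d w) = d w'.
Proof.
move=> dx; have [s [f [us gf xE df]]] := gr_decd dx.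
exists (\sum_(k <- s) ((-1) ^ k)^-1 *: mul (f k) w).
rewrite linear_sum xE dga_mul_suml big_seq [RHS]big_seq.
apply: eq_bigr => k ks; rewrite linearZ /= (dga_leibniz _ (gf k)) df //.
by rewrite dga_mul0l add0r scalerK // expfz_neq0 // oppr_eq0 oner_eq0.
Qed.

Lemma dga_mul_cocycle x y : d x = 0 -> d y = 0 -> d (mul x y) = 0.
Proof.
move=> dx dy; have [s [f [us gf -> df]]] := gr_decd dx.
rewrite dga_mul_suml linear_sum big_seq big1 // => k ks /=.
by rewrite (dga_leibniz _ (gf k)) df // dy dga_mul0l dga_mul0r scaler0 addr0.
Qed.

Lemma hmulE x y : d x = 0 -> d y = 0 ->
  hmul (hclass x) (hclass y) = hclass (mul x y).
Proof.
move=> dx dy; rewrite /hmul.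
have [w ->] := hrepr_hclass dx; have [w' ->] := hrepr_hclass dy.
have dy' : d (y + d w') = 0 by rewrite dD0 ?dga_dd.
have [v ev] := dga_mul_d w' dx.
have [s [f [us gf wE]]] := gr_dec w.
pose u := \sum_(k <- s) mul (f k) (y + d w').
have eu : mul (d w) (y + d w') = d u.
  rewrite wE linear_sum dga_mul_suml linear_sum; apply: eq_bigr => k _ /=.
  by rewrite (dga_leibniz _ (gf k)) dy' dga_mul0r scaler0 addr0.
apply: (@hclass_eq _ _ (v + u)); first exact: dga_mul_cocycle.
by rewrite dga_mulDl eu dga_mulDr ev linearD addrA.
Qed.

Definition hgr (k : int) (c : cohomology) : Prop :=
  exists x, [/\ gr k x, d x = 0 & c = hclass x].

Fact hmulA : associative hmul.
Proof.
elim/hclassW=> x dx; elim/hclassW=> y dy; elim/hclassW=> z dz.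
by rewrite !hmulE ?dga_mulA //; apply: dga_mul_cocycle.
Qed.
Fact hmul1 : left_id (hclass (dga_one E)) hmul.
Proof. by elim/hclassW=> x dx; rewrite hmulE ?dga_mul1 ?dga_d1. Qed.
Fact hmulr1 : right_id (hclass (dga_one E)) hmul.
Proof. by elim/hclassW=> x dx; rewrite hmulE ?dga_mulr1 ?dga_d1. Qed.
Fact hmul_linearl c : linear (hmul^~ c).
Proof.
move=> a; elim/hclassW: c => z dz; elim/hclassW=> x dx; elim/hclassW=> y dy.
have dax := dZ0 a dx; have dxy := dD0 dax dy.
rewrite /= -hclassZ // -hclassD // !hmulE // dga_mullP.
by rewrite hclassD ?hclassZ //; do ?apply: dZ0; apply: dga_mul_cocycle.
Qed.
Fact hmul_linearr c : linear (hmul c).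
Proof.
move=> a; elim/hclassW: c => z dz; elim/hclassW=> x dx; elim/hclassW=> y dy.
have dax := dZ0 a dx; have dxy := dD0 dax dy.
rewrite /= -hclassZ // -hclassD // !hmulE // dga_mulrP.
by rewrite hclassD ?hclassZ //; do ?apply: dZ0; apply: dga_mul_cocycle.
Qed.
Fact hgrM k l c c' : hgr k c -> hgr l c' -> hgr (k + l) (hmul c c').
Proof.
move=> [x [gx dx ->]] [y [gy dy ->]]; exists (mul x y).
by split; [apply: dga_grM|apply: dga_mul_cocycle|rewrite hmulE].
Qed.
Fact hgr1 : hgr 0 (hclass (dga_one E)).
Proof. by exists (dga_one E); split=> //; [apply: dga_gr1|apply: dga_d1]. Qed.

Fact hgrading : is_grading hgr.
Proof.
split=> [k|k a c c' [x [gx dx ->]] [y [gy dy ->]]| |s f us gf sf0 k ks].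
- by exists 0; split; [apply: gr0|apply: linear0|].
- exists (a *: x + y); split; [exact: grP|by apply: dD0 => //; apply: dZ0|].
  by rewrite hclassD ?hclassZ //; apply: dZ0.
- elim/hclassW=> x dx; have [s [f [us gf xE df]]] := gr_decd dx.
  exists s, (fun k => if k \in s then hclass (f k) else 0); split=> // [k|].
    case: ifPn => ks; first by exists (f k); split=> //; apply: df.
    by exists 0; split; [apply: gr0|apply: linear0|].
  rewrite xE (hclass_sum df).1 big_seq [RHS]big_seq.
  by apply: eq_bigr => k ->.
have [g gP] := boolp.choice gf.
have [e ds] := @hclass_sum _ s g (fun i _ => let: And3 _ dg _ := gP i in dg).
have fE i : f i = hclass (g i) by case: (gP i).
move: sf0; under eq_bigr do rewrite fE.
rewrite -e => /(hclass_eq0 ds)[w wE].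
have [t [h [ut gh wE']]] := gr_dec w.
pose F j := (if j \in s then g j else 0) - (if j - 1 \in t then d (h (j - 1)) else 0).
have gF j : gr j (F j).
  apply: grD; first by case: ifP => _; [case: (gP j)|apply: gr0].
  apply: grN; case: ifP => _; last exact: gr0.
  by have := dga_grd (gh (j - 1)); rewrite subrK.
pose r := undup (s ++ [seq j + 1 | j <- t]).
have ur : uniq r by apply: undup_uniq.
have sumr (G : int -> E) (q : seq int) : uniq q -> {subset q <= r} ->
    \sum_(j <- r) (if j \in q then G j else 0) = \sum_(j <- q) G j.
  move=> uq qr; rewrite -big_mkcond -big_filter; apply: perm_big.
  apply: uniq_perm => //; first exact: filter_uniq.
  by move=> j; rewrite mem_filter; apply: andb_idr; apply: qr.
have Fsum : \sum_(j <- r) F j = 0.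
  rewrite sumrB sumr //; last by move=> j js; rewrite mem_undup mem_cat js.
  have -> : \sum_(j <- r) (if j - 1 \in t then d (h (j - 1)) else 0) =
            \sum_(j <- r) (if j \in [seq j + 1 | j <- t] then d (h (j - 1)) else 0).
    apply: eq_bigr => j _; congr (if _ then _ else _); apply/idP/mapP => [jt|].
      by exists (j - 1); rewrite ?subrK.
    by case=> l lt ->; rewrite addrK.
  rewrite (sumr (fun j => d (h (j - 1)))); first last.
  - by move=> j jt; rewrite mem_undup mem_cat jt orbT.
  - by rewrite map_inj_uniq //; apply: addIr.
  rewrite big_map; under [X in _ - X]eq_bigr do rewrite addrK.
  by rewrite -linear_sum -wE' wE subrr.
have : F k = 0.
  by apply: (gr_indep ur gF Fsum); rewrite mem_undup mem_cat ks.
rewrite /F ks => /eqP; rewrite subr_eq0 => /eqP gk.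
rewrite fE; apply/hclass_eq0; first by case: (gP k).
by rewrite gk; case: ifP => _; [exists (h (k - 1))|exists 0; rewrite linear0].
Qed.

Fact hzero_grd k c : hgr k c -> hgr (k + 1) ((fun=> 0) c).
Proof. by move=> _; case: hgrading. Qed.
Fact hzero_linear : linear (fun _ : cohomology => 0 : cohomology).
Proof. by move=> a u v; rewrite scaler0 addr0. Qed.
Fact hzero_leibniz k c c' : hgr k c -> (0 : cohomology) =
  hmul 0 c' + ((-1) ^ k : rat) *: hmul c 0.
Proof.
move=> _; have l0 : hmul 0 c' = 0.
  have := @hmul_linearl c' (-1) 0 0; by rewrite !scaleN1r !addNr.
have r0 : hmul c 0 = 0.
  have := @hmul_linearr c (-1) 0 0; by rewrite !scaleN1r !addNr.
by rewrite l0 r0 scaler0 addr0.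
Qed.

Definition cohomology_dga : dga :=
  @DGA cohomology (hclass (dga_one E)) hmul (fun=> 0) hgr hmulA hmul1 hmulr1
    hmul_linearl hmul_linearr hgrading hgr1 hgrM hzero_linear hzero_grd
    (fun=> erefl) hzero_leibniz.

End Cohomology.

Section QuasiIsomorphism.
Variables E F : dga.

Definition dga_morphism (f : E -> F) : Prop :=
  [/\ linear f,
      f (dga_one E) = dga_one F,
      forall x y, f (dga_mul x y) = dga_mul (f x) (f y),
      forall k x, dga_gr k x -> dga_gr k (f x)
    & forall x, f (dga_d x) = dga_d (f x)].

(* Evaluated on a representative; see cohomology_mapE for the independence of
   this choice. *)
Definition cohomology_map (f : E -> F) (c : cohomology E) : cohomology F :=
  hclass (f (hrepr c)).

Lemma cohomology_mapE f x : dga_morphism f -> dga_d x = 0 ->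
  cohomology_map f (hclass x) = hclass (f x).
Proof.
move=> [lf _ _ _ fd] dx; have [w e] := hrepr_hclass dx.
have f0 : f 0 = 0.
  by have := lf (-1) 0 0; rewrite !scaleN1r !addNr.
rewrite /cohomology_map e addrC; apply: (@hclass_eq _ _ _ (f w)).
  by rewrite -fd dx.
by have := lf 1 (dga_d w) x; rewrite !scale1r => ->; rewrite fd addrC.
Qed.

Definition quasi_isomorphism (f : E -> F) : Prop :=
  dga_morphism f /\ bijective (cohomology_map f).

End QuasiIsomorphism.

Definition formal (E : dga) : Prop :=
  exists (m : nat) (S : nat -> dga),
    [/\ S 0%N = E, S m = cohomology_dga E
      & forall i, (i < m)%N ->
          (exists f : S i -> S i.+1, quasi_isomorphism f) \/
          (exists f : S i.+1 -> S i, quasi_isomorphism f)].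

Section ShuffleSign.
Variable n : nat.
Implicit Types s t u : {set 'I_n}.

(* enum lists a set of ordinals in increasing order. The permutation is the
   unique one if s and t are disjoint (shuffleP), and 1 otherwise. *)
Definition shuffle s t : 'S_#|s :|: t| :=
  odflt 1%g [pick p : 'S_#|s :|: t| |
    enum s ++ enum t == [seq enum_val (p k) | k <- enum 'I_#|s :|: t|]].

Lemma shuffleP s t : [disjoint s & t] ->
  enum s ++ enum t = [seq enum_val (shuffle s t k) | k <- enum 'I_#|s :|: t|].
Proof.
move=> dst; rewrite /shuffle; case: pickP => [p /eqP //|noP].
have : perm_eq (enum s ++ enum t) (enum_tuple (s :|: t)).
  apply: uniq_perm; rewrite ?enum_uniq //.
    rewrite cat_uniq !enum_uniq andbT /=; apply/hasPn => i.
    by rewrite !mem_enum; apply: contraL => /(disjointFr dst) ->.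
  by move=> i; rewrite mem_cat !mem_enum inE.
case/tuple_permP => p e; have /eqP[] := noP p.
rewrite e /=; apply: eq_map => k /=.
rewrite (tnth_nth (enum_default (p k))) /=.
by rewrite (enum_val_nth (enum_default (p k))).
Qed.

Fixpoint vdm (w : seq rat) : rat :=
  if w is x :: w' then (\prod_(y <- w') (y - x)) * vdm w' else 1.

Lemma vdmE m (f : 'I_m -> rat) :
  \prod_(i < m) \prod_(j < m | (i < j)%N) (f j - f i) =
  vdm [seq f i | i <- enum 'I_m].
Proof.
elim: m f => [|m IH] f; first by rewrite big_ord0 (size0nil (size_enum_ord 0)).
rewrite big_ord_recl enum_ordSl /= -map_comp -IH; congr (_ * _).
  by rewrite big_mkcond big_ord_recl /= mul1r big_map big_enum.
apply: eq_bigr => i _; rewrite big_mkcond big_ord_recl /= mul1r -big_mkcond /=.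
by apply: eq_bigl => j; rewrite /bump !add1n.
Qed.

Lemma vdm_cat w1 w2 : vdm (w1 ++ w2) =
  (\prod_(x <- w1) \prod_(y <- w2) (y - x)) * (vdm w1 * vdm w2).
Proof.
elim: w1 => [|x w IH] /=; first by rewrite big_nil !mul1r.
by rewrite IH big_cat big_cons /=; ring.
Qed.

Lemma vdm_enum_gt0 s : 0 < vdm [seq (nat_of_ord i)%:R | i <- enum s].
Proof.
have : sorted ltn [seq nat_of_ord i | i <- enum s].
  rewrite sorted_map /enum_mem -enumT; apply: sorted_filter.
    by move=> j i k; apply: ltn_trans.
  by rewrite -sorted_map val_enum_ord iota_ltn_sorted.
elim: (enum s) => //= i w IH; rewrite (path_sortedE ltn_trans) => /andP[/allP iw sw].
rewrite mulr_gt0 ?IH // big_map big_seq prodr_gt0 // => j jw.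
by rewrite subr_gt0 ltr_nat iw // map_f.
Qed.

Definition chi (j i : 'I_n) : rat := (-1) ^+ (j < i)%N.
Definition lo s i : rat := \prod_(j in s) chi j i.
Definition sg s t : rat := \prod_(i in s) lo t i.

Lemma shuffle_sign s t : [disjoint s & t] -> (-1) ^+ shuffle s t = sg s t.
Proof.
move=> dst; set p := shuffle s t; set m := #|s :|: t| in p *.
pose a : 'rV[rat]_m := \row_k ((enum_val k : 'I_n) : nat)%:R.
pose b : 'rV[rat]_m := \row_k ((enum_val (p k) : 'I_n) : nat)%:R.
have ab : Vandermonde m b = col_perm p (Vandermonde m a).
  by apply/matrixP => i j; rewrite !mxE.
have := congr1 determinant ab.
rewrite col_permE det_mulmx det_perm !det_Vandermonde odd_permV !vdmE.
have -> : [seq b 0 i | i <- enum 'I_m] =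
    [seq (nat_of_ord i)%:R | i <- enum s] ++ [seq (nat_of_ord i)%:R | i <- enum t].
  rewrite -map_cat (shuffleP dst) -[RHS]map_comp.
  by apply/eq_in_map => k _; rewrite mxE.
have -> : [seq a 0 i | i <- enum 'I_m] = [seq (nat_of_ord i)%:R | i <- enum (s :|: t)].
  rewrite -[in RHS](map_tnth_enum (enum_tuple (s :|: t))) -[RHS]map_comp.
  apply: eq_map => k; rewrite mxE /=; congr (nat_of_ord _)%:R.
  by rewrite (tnth_nth (enum_default k)) (enum_val_nth (enum_default k)).
rewrite vdm_cat => /(congr1 Num.sg).
rewrite !sgrM !(gtr0_sg (vdm_enum_gt0 _)) !mulr1 mul1r.
have -> : Num.sg ((-1) ^+ p : rat) = (-1) ^+ p.
  by case: (p : bool); rewrite ?expr1 ?expr0 ?sgrN ?sgr1.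
move=> <-; rewrite big_map big_enum (big_morph _ (@sgrM _) (@sgr1 _)).
apply: eq_bigr => i si; rewrite big_map big_enum (big_morph _ (@sgrM _) (@sgr1 _)).
apply: eq_bigr => j tj; rewrite /chi; case: ltngtP => ij /=.
- by rewrite ltr0_sg // subr_lt0 ltr_nat.
- by rewrite gtr0_sg // subr_gt0 ltr_nat.
by move/val_inj: ij tj => ->; rewrite (disjointFr dst).
Qed.

Lemma chiC i j : i != j -> chi j i = - chi i j.
Proof.
move=> ij; rewrite /chi; case: (ltngtP (nat_of_ord j) i) => [_|_|/val_inj e].
- by rewrite ?expr1 ?expr0.
- by rewrite ?expr1 ?opprK ?expr0.
by rewrite e eqxx in ij.
Qed.
Lemma chi_sqr i j : chi i j * chi i j = 1.
Proof. by rewrite /chi -signr_addb addbb. Qed.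
Lemma lo_sqr s i : lo s i * lo s i = 1.
Proof. by rewrite /lo -big_split /= big1 // => j _; apply: chi_sqr. Qed.
Lemma loU s t i : [disjoint s & t] -> lo (s :|: t) i = lo s i * lo t i.
Proof. by move=> dst; rewrite /lo -bigU //; apply: eq_bigl => k; rewrite !inE. Qed.
Lemma sgUl s t u : [disjoint s & t] -> sg (s :|: t) u = sg s u * sg t u.
Proof. by move=> dst; rewrite /sg -bigU //; apply: eq_bigl => k; rewrite !inE. Qed.
Lemma sgUr s t u : [disjoint t & u] -> sg s (t :|: u) = sg s t * sg s u.
Proof. by move=> dtu; rewrite /sg -big_split; apply: eq_bigr => i _; apply: loU. Qed.
Lemma sgD1l s t i : i \in s -> sg s t = lo t i * sg (s :\ i) t.
Proof. by move=> si; rewrite /sg (big_setD1 i). Qed.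
Lemma loD1 s i j : j \in s -> lo s i = chi j i * lo (s :\ j) i.
Proof. by move=> sj; rewrite /lo (big_setD1 j). Qed.
Lemma sgD1r s t j : j \in t -> j \notin s ->
  sg s t = (-1) ^+ #|s| * lo s j * sg s (t :\ j).
Proof.
move=> tj sj; rewrite /sg -prodr_const -!big_split; apply: eq_bigr => i si /=.
by rewrite (loD1 _ tj) chiC ?mulN1r //; apply: contraNneq sj => <-.
Qed.

(* If i is the j-th smallest element of s, counting from 1, then the exponent
   is j. *)
Definition pos_sign s i : rat := (-1) ^+ #|[set k in s | (k <= i)%N]|.

Lemma pos_signE s i : i \in s -> pos_sign s i = - lo s i.
Proof.
move=> si; rewrite /pos_sign -prodr_const.
rewrite (eq_bigl (fun k => (k \in s) && (k <= i)%N)); last by move=> k; rewrite inE.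
rewrite big_mkcondr (bigD1 i) //= leqnn mulN1r /lo [in RHS](bigD1 i) //= /chi ltnn expr0 mul1r.
congr (- _); apply: eq_bigr => k /andP[_ ki]; rewrite leq_eqVlt.
by rewrite (inj_eq val_inj) (negPf ki) /=; case: ltnP.
Qed.

End ShuffleSign.

Section RelativeAtomicDGA.
Variables (K : fieldType) (V : vectType K) (n : nat) (A : arrangement V n).
Implicit Types s t : {set 'I_n}.
Local Notation vee := (vee A).

Definition ra_space : Type := {ffun {set 'I_n} -> rat^o}.
HB.instance Definition _ := GRing.Lmodule.on ra_space.
Implicit Types x y z : ra_space.

Definition ra_basis s : ra_space := [ffun t => (t == s)%:R].

Definition ra_degree s : int := (2 * cd (vee s))%:Z - #|s|%:Z.

Definition ra_d_basis s : ra_space :=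
  \sum_(i in s | vee (s :\ i) == vee s) pos_sign s i *: ra_basis (s :\ i).

Definition ra_mul_basis s t : ra_space :=
  if (cd (vee s) + cd (vee t) == cd (vee (s :|: t)))%N
  then ((-1) ^+ shuffle s t : rat) *: ra_basis (s :|: t) else 0.

Definition ra_d x : ra_space := \sum_s x s *: ra_d_basis s.

Definition ra_mul x y : ra_space :=
  \sum_s \sum_t (x s * y t) *: ra_mul_basis s t.

Definition ra_gr (k : int) x : Prop := forall s, x s != 0 -> ra_degree s = k.

Lemma ra_coordE x : x = \sum_s x s *: ra_basis s.
Proof.
apply/ffunP => t; rewrite sum_ffunE (bigD1 t) //= big1 => [|s st].
  by rewrite !ffunE eqxx addr0 /GRing.scale /= mulr1.
by rewrite !ffunE eq_sym (negPf st) /GRing.scale /= mulr0.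
Qed.

Lemma coordD a x y s : (a *: x + y) s = a * x s + y s.
Proof. by rewrite !ffunE. Qed.

Lemma ra_ext (M : lmodType rat) (f g : ra_space -> M) :
  linear f -> linear g -> (forall s, f (ra_basis s) = g (ra_basis s)) -> f =1 g.
Proof.
move=> lf lg fg x; rewrite (ra_coordE x).
have l0 (h : ra_space -> M) : linear h -> h 0 = 0.
  by move=> lh; have := lh (-1) 0 0; rewrite !scaleN1r !addNr.
by elim/big_rec: _ => [|s y _ IH]; rewrite ?l0 // lf lg IH fg.
Qed.

Lemma ra_d_linear : linear ra_d.
Proof.
move=> a x y; rewrite /ra_d scaler_sumr -big_split; apply: eq_bigr => s _ /=.
by rewrite coordD scalerDl scalerA.
Qed.
HB.instance Definition _ :=
  GRing.isLinear.Build rat ra_space ra_space *:%R ra_d ra_d_linear.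

Lemma ra_mul_linearl y : linear (ra_mul^~ y).
Proof.
move=> a u v; rewrite /ra_mul scaler_sumr -big_split; apply: eq_bigr => s _ /=.
rewrite scaler_sumr -big_split; apply: eq_bigr => t _ /=.
by rewrite coordD mulrDl scalerDl scalerA mulrA.
Qed.
Lemma ra_mul_linearr x : linear (ra_mul x).
Proof.
move=> a u v; rewrite /ra_mul scaler_sumr -big_split; apply: eq_bigr => s _ /=.
rewrite scaler_sumr -big_split; apply: eq_bigr => t _ /=.
by rewrite coordD mulrDr scalerDl scalerA mulrCA.
Qed.
Lemma ra_mullP y a u v : ra_mul (a *: u + v) y = a *: ra_mul u y + ra_mul v y.
Proof. exact: ra_mul_linearl. Qed.
Lemma ra_mulrP x a u v : ra_mul x (a *: u + v) = a *: ra_mul x u + ra_mul x v.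
Proof. exact: ra_mul_linearr. Qed.
Definition ra_mulr y x := ra_mul x y.
HB.instance Definition _ x :=
  GRing.isLinear.Build rat ra_space ra_space *:%R (ra_mul x) (ra_mul_linearr x).
HB.instance Definition _ y :=
  GRing.isLinear.Build rat ra_space ra_space *:%R (ra_mulr y) (ra_mul_linearl y).

Lemma sum_basis (M : lmodType rat) (F : {set 'I_n} -> M) s :
  \sum_t ra_basis s t *: F t = F s.
Proof.
rewrite (bigD1 s) //= big1 => [|t ts]; first by rewrite ffunE eqxx scale1r addr0.
by rewrite ffunE (negPf ts) scale0r.
Qed.

Lemma ra_d_basisE s : ra_d (ra_basis s) = ra_d_basis s.
Proof. exact: sum_basis. Qed.
Lemma ra_mul_basisE s t : ra_mul (ra_basis s) (ra_basis t) = ra_mul_basis s t.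
Proof.
rewrite /ra_mul -[RHS](sum_basis (fun s => ra_mul_basis s t)); apply: eq_bigr => s' _.
under eq_bigr do rewrite -scalerA.
by rewrite -scaler_sumr sum_basis.
Qed.

Lemma vee_val s : ssval (vee s) = intersection A s.
Proof. by rewrite veeE. Qed.

Lemma ssvalU (a b : intersection_lattice A) :
  ssval (a `|` b)%O = (ssval a :&: ssval b)%VS.
Proof. exact: il_joinE. Qed.

Lemma veeU s t : vee (s :|: t) = (vee s `|` vee t)%O.
Proof.
apply/val_inj; rewrite !veeE [RHS]ssvalU /=; apply/eqP; rewrite eqEsubv subv_cap -andbA.
apply/and3P; split; apply/sub_intersectionP => i.
- by move=> si; apply: bigcapv_inf (subvv _); rewrite inE si.
- by move=> ti; apply: bigcapv_inf (subvv _); rewrite inE ti orbT.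
rewrite inE => /orP[] H; [apply: subv_trans (capvSl _ _) _|apply: subv_trans (capvSr _ _) _];
  exact: bigcapv_inf (subvv _).
Qed.

Lemma vee_sub s t : s \subset t -> (vee s <= vee t)%O.
Proof. by move=> /setUidPr <-; rewrite veeU leUl. Qed.

Lemma cdU s t : (cd (vee (s :|: t)) <= cd (vee s) + cd (vee t))%N.
Proof.
rewrite veeU /cd ssvalU.
have := dimv_sum_cap (ssval (vee s)) (ssval (vee t)).
have := dimvS (subvf (ssval (vee s) + ssval (vee t))%VS).
have := dimvS (subvf (ssval (vee s))); have := dimvS (subvf (ssval (vee t))).
lia.
Qed.

Lemma cd_le (a b : intersection_lattice A) : (a <= b)%O -> (cd a <= cd b)%N.
Proof. by rewrite leEil => /dimvS; rewrite /cd; lia. Qed.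

Lemma cd_eq (a b : intersection_lattice A) :
  (a <= b)%O -> (cd b <= cd a)%N -> a = b.
Proof.
rewrite leEil => ba H; apply/val_inj/esym/eqP; rewrite eqEdim ba /=.
have := dimvS (subvf (ssval a)); have := dimvS (subvf (ssval b)); move: H.
by rewrite /cd; lia.
Qed.

Definition ra_cond s t := (cd (vee s) + cd (vee t) == cd (vee (s :|: t)))%N.

Lemma ra_cond_disjoint s t : ra_cond s t -> [disjoint s & t].
Proof.
move=> /eqP c; rewrite -setI_eq0; apply: contraT => /set0Pn[k]; rewrite inE => /andP[si ti].
have : (ssval (vee s) + ssval (vee t) <= A k)%VS.
  by rewrite subv_add !vee_val; apply/andP; split; apply: bigcapv_inf (subvv _).
have := subspace_proper A k; rewrite eqEdim subvf /= -ltnNge => Ak /dimvS.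
have := dimv_sum_cap (ssval (vee s)) (ssval (vee t)); move: c Ak.
rewrite veeU /cd ssvalU.
have := dimvS (subvf (ssval (vee s))); have := dimvS (subvf (ssval (vee t))).
have := dimvS (capvSl (ssval (vee s)) (ssval (vee t))).
lia.
Qed.

Lemma ra_mul_basisE' s t : ra_mul_basis s t =
  if ra_cond s t then sg s t *: ra_basis (s :|: t) else 0.
Proof.
rewrite /ra_mul_basis -/(ra_cond s t); case: ifP => // /ra_cond_disjoint dst.
by rewrite shuffle_sign.
Qed.

Lemma ra_d_basisE' s : ra_d_basis s =
  \sum_(i in s | vee (s :\ i) == vee s) (- lo s i) *: ra_basis (s :\ i).
Proof. by apply: eq_bigr => i /andP[si _]; rewrite pos_signE. Qed.

Lemma ra_condA s t u :
  ra_cond s t && ra_cond (s :|: t) u = ra_cond t u && ra_cond s (t :|: u).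
Proof.
rewrite /ra_cond -!setUA; have := cdU s t; have := cdU (s :|: t) u.
have := cdU t u; have := cdU s (t :|: u); rewrite -!setUA.
by move=> H1 H2 H3 H4; apply/andP/andP => -[/eqP e1 /eqP e2]; split; apply/eqP; lia.
Qed.

Lemma ra_mulA : associative ra_mul.
Proof.
move=> x y z.
apply: (ra_ext (f := fun x => ra_mul x (ra_mul y z))
               (g := fun x => ra_mul (ra_mul x y) z)) => [a b c|a b c|s] /=.
- by rewrite ra_mullP.
- by rewrite !ra_mullP.
apply: (ra_ext (f := fun y => ra_mul (ra_basis s) (ra_mul y z))
               (g := fun y => ra_mul (ra_mul (ra_basis s) y) z)) => [a b c|a b c|t] /=.
- by rewrite ra_mullP ra_mulrP.
- by rewrite ra_mulrP ra_mullP.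
apply: (ra_ext (f := fun z => ra_mul (ra_basis s) (ra_mul (ra_basis t) z))
               (g := fun z => ra_mul (ra_mul (ra_basis s) (ra_basis t)) z)) => [a b c|a b c|u] /=.
- by rewrite !ra_mulrP.
- by rewrite ra_mulrP.
rewrite !ra_mul_basisE !ra_mul_basisE'.
have := ra_condA s t u; case: ifP => c1; case: ifP => c2 /=; last first.
- by rewrite linear0 -[ra_mul 0 _]/(ra_mulr _ 0) linear0.
- rewrite linear0 -[ra_mul (_ *: _) _]/(ra_mulr _ _) linearZ /= /ra_mulr.
  by rewrite ra_mul_basisE ra_mul_basisE' => ->; rewrite scaler0.
- rewrite linearZ /= -[ra_mul 0 _]/(ra_mulr _ 0) linear0.
  by rewrite ra_mul_basisE ra_mul_basisE' => <-; rewrite scaler0.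
rewrite linearZ /= -[ra_mul (_ *: _) _]/(ra_mulr _ _) linearZ /= /ra_mulr.
rewrite !ra_mul_basisE !ra_mul_basisE' => ->; case: ifP => c3; last by rewrite !scaler0.
rewrite !scalerA setUA; congr (_ *: _).
have dst := ra_cond_disjoint c2; have dtu := ra_cond_disjoint c1.
by rewrite sgUl // sgUr //; ring.
Qed.

Lemma cd0 : cd (vee set0) = 0%N.
Proof. by rewrite /cd vee_val /intersection big_set0 subnn. Qed.

Lemma sg0s t : sg set0 t = 1. Proof. exact: big_set0. Qed.
Lemma sgs0 s : sg s set0 = 1.
Proof. by rewrite /sg big1 // => i _; apply: big_set0. Qed.

Lemma ra_mul1 : left_id (ra_basis set0) ra_mul.
Proof.
apply: (ra_ext (g := id)) => // [|t]; first exact: ra_mul_linearr.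
rewrite ra_mul_basisE ra_mul_basisE' /ra_cond cd0 set0U eqxx.
by rewrite sg0s scale1r.
Qed.
Lemma ra_mulr1 : right_id (ra_basis set0) ra_mul.
Proof.
apply: (ra_ext (g := id)) => // [|t]; first exact: ra_mul_linearl.
rewrite ra_mul_basisE ra_mul_basisE' /ra_cond cd0 setU0 addn0 eqxx.
by rewrite sgs0 scale1r.
Qed.

Lemma ra_grP k a x y : ra_gr k x -> ra_gr k y -> ra_gr k (a *: x + y).
Proof.
move=> gx gy s; rewrite coordD => H.
have [x0|/gx //] := eqVneq (x s) 0; have [y0|/gy //] := eqVneq (y s) 0.
by rewrite x0 y0 mulr0 addr0 eqxx in H.
Qed.
Lemma ra_gr0 k : ra_gr k 0. Proof. by move=> s; rewrite ffunE eqxx. Qed.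
Lemma ra_grZ k a x : ra_gr k x -> ra_gr k (a *: x).
Proof. by move=> gx; rewrite -[_ *: _]addr0; apply: ra_grP => //; apply: ra_gr0. Qed.
Lemma ra_gr_sum k (I : finType) (P : pred I) (F : I -> ra_space) :
  (forall i, P i -> ra_gr k (F i)) -> ra_gr k (\sum_(i | P i) F i).
Proof.
move=> H; elim/big_rec: _ => [|i x Pi gx]; first exact: ra_gr0.
by rewrite -[F i]scale1r; apply: ra_grP => //; apply: H.
Qed.
Lemma ra_gr_basis s : ra_gr (ra_degree s) (ra_basis s).
Proof. by move=> t; rewrite ffunE; case: (t =P s) => [->|]; rewrite ?eqxx. Qed.

Lemma ra_grading : is_grading ra_gr.
Proof.
split=> [k|k a x y|x|S f uS gf sf0 k kS]; [exact: ra_gr0|exact: ra_grP| |].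
  exists (undup [seq ra_degree s | s : {set 'I_n}]).
  exists (fun k => [ffun s => if ra_degree s == k then x s else 0]); split.
  - exact: undup_uniq.
  - by move=> k s; rewrite ffunE; case: (ra_degree s =P k) => //; rewrite eqxx.
  apply/ffunP => t; rewrite sum_ffunE (bigD1_seq (ra_degree t)) ?undup_uniq //=; last first.
    by rewrite mem_undup; apply: map_f; rewrite mem_enum.
  rewrite ffunE eqxx big1 ?addr0 // => k kt.
  by rewrite ffunE eq_sym (negPf kt).
apply/ffunP => t; rewrite [RHS]ffunE; have [kt|kt] := eqVneq (ra_degree t) k; last first.
  by apply: contraNeq kt => /gf /eqP.
move/ffunP/(_ t): sf0; rewrite sum_ffunE (bigD1_seq k) //= big1 => [|j jk].
  by rewrite ffunE addr0.
by apply: contraNeq jk => /gf <-; rewrite kt.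
Qed.

Lemma ra_gr1 : ra_gr 0 (ra_basis set0).
Proof.
have := @ra_gr_basis set0; by rewrite /ra_degree cd0 cards0.
Qed.

Lemma ra_grM k l x y : ra_gr k x -> ra_gr l y -> ra_gr (k + l) (ra_mul x y).
Proof.
move=> gx gy; apply: ra_gr_sum => s _; apply: ra_gr_sum => t _.
have [->|/gx xs] := eqVneq (x s) 0; first by rewrite mul0r scale0r; apply: ra_gr0.
have [->|/gy yt] := eqVneq (y t) 0; first by rewrite mulr0 scale0r; apply: ra_gr0.
apply: ra_grZ; rewrite ra_mul_basisE'; case: ifP => [c|_]; last exact: ra_gr0.
apply: ra_grZ; suff <- : ra_degree (s :|: t) = k + l by apply: ra_gr_basis.
have := ra_cond_disjoint c; rewrite -setI_eq0 => /eqP st0.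
by rewrite -xs -yt /ra_degree -(eqP c) cardsU st0 cards0 subn0; lia.
Qed.

Lemma ra_grd k x : ra_gr k x -> ra_gr (k + 1) (ra_d x).
Proof.
move=> gx; apply: ra_gr_sum => s _.
have [->|/gx xs] := eqVneq (x s) 0; first by rewrite scale0r; apply: ra_gr0.
apply: ra_grZ; apply: ra_gr_sum => i /andP[si /eqP e]; apply: ra_grZ.
suff <- : ra_degree (s :\ i) = k + 1 by apply: ra_gr_basis.
by rewrite -xs /ra_degree e (cardsD1 i s) si; lia.
Qed.

Lemma vee_eq s t (u : {set _}) : s \subset t -> t \subset u -> 
  (vee s == vee u) = (vee s == vee t) && (vee t == vee u).
Proof.
move=> /vee_sub st /vee_sub tu; apply/eqP/andP => [e|[/eqP -> /eqP //]].
suff e' : vee t = vee u by rewrite e e' !eqxx.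
by apply: le_anti; rewrite tu -e st.
Qed.

Lemma ra_dd x : ra_d (ra_d x) = 0.
Proof.
apply: (ra_ext (f := fun x => ra_d (ra_d x)) (g := fun=> 0)) => [a u v|a u v|s].
- by rewrite !linearP.
- by rewrite scaler0 addr0.
rewrite ra_d_basisE ra_d_basisE' linear_sum.
pose G i j := if [&& i \in s, j \in s, i != j & vee (s :\ i :\ j) == vee s]
  then (lo s i * lo (s :\ i) j) *: ra_basis (s :\ i :\ j) else 0.
have -> : \sum_(i in s | vee (s :\ i) == vee s)
    ra_d ((- lo s i) *: ra_basis (s :\ i)) = \sum_i \sum_j G i j.
  rewrite big_mkcond; apply: eq_bigr => i _; case: ifP => [/andP[si e]|H].
    rewrite linearZ /= ra_d_basisE ra_d_basisE' scaler_sumr big_mkcond.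
    apply: eq_bigr => j _; rewrite /G si !inE /= (vee_eq (subsetDl _ [set j]) (subsetDl s [set i])) e andbT.
    rewrite [j == i]eq_sym andbCA andbA; case: ifP => // _.
    by rewrite scalerA mulrNN.
  rewrite big1 // => j _; rewrite /G (vee_eq (subsetDl _ [set j]) (subsetDl s [set i])).
  by move: H; case: (i \in s) => //= ->; rewrite !andbF.
have anti i j : G i j = - G j i.
  have sw : s :\ j :\ i = s :\ i :\ j by rewrite setDDl setUC -setDDl.
  rewrite /G sw [j == i]eq_sym; case: (boolP (i \in s)) => si; last first.
    by rewrite /= andbF oppr0.
  case: (boolP (j \in s)) => sj /=; last by rewrite oppr0.
  case: ifP => [/andP[ij _]|_]; last by rewrite oppr0.
  rewrite -scaleNr; congr (_ *: _).
  by rewrite (loD1 i sj) (loD1 j si) (chiC ij); ring.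
have : \sum_i \sum_j G i j = - \sum_i \sum_j G i j.
  rewrite [in LHS]exchange_big -sumrN; apply: eq_bigr => i _.
  by rewrite -sumrN; apply: eq_bigr => j _; apply: anti.
move/eqP; rewrite -addr_eq0 -mulr2n -scaler_nat scaler_eq0 pnatr_eq0 /= => /eqP.
by [].
Qed.

Definition ra_twist x : ra_space := \sum_s (x s * (-1) ^+ #|s|) *: ra_basis s.
Lemma ra_twistP a u v : ra_twist (a *: u + v) = a *: ra_twist u + ra_twist v.
Proof.
rewrite /ra_twist scaler_sumr -big_split; apply: eq_bigr => s _ /=.
by rewrite coordD mulrDl scalerDl scalerA mulrA.
Qed.
Lemma ra_twist_basis s : ra_twist (ra_basis s) = (-1) ^+ #|s| *: ra_basis s.
Proof.
rewrite /ra_twist; under eq_bigr do rewrite -scalerA.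
exact: sum_basis.
Qed.
Lemma ra_twist_gr k x : ra_gr k x -> ra_twist x = ((-1) ^ k : rat) *: x.
Proof.
move=> gx; rewrite [in RHS](ra_coordE x) scaler_sumr; apply: eq_bigr => s _.
have [->|/gx <-] := eqVneq (x s) 0; first by rewrite mul0r !scale0r scaler0.
rewrite scalerA mulrC; congr (_ * _ *: _).
rewrite /ra_degree expfzDr ?oppr_eq0 ?oner_eq0 // -exprnN invr_sign -exprnP.
by rewrite -[(-1) ^+ (2 * _)]signr_odd oddM expr0 mul1r.
Qed.

Lemma setD1Ul s t i : i \notin t -> (s :|: t) :\ i = (s :\ i) :|: t.
Proof.
move=> ti; apply/setP => j; rewrite !inE; case: eqP => //= ->.
by rewrite (negPf ti).
Qed.

Lemma ra_condC s t : ra_cond s t = ra_cond t s.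
Proof. by rewrite /ra_cond addnC setUC. Qed.

Lemma ra_condD1l s t i : i \in s ->
  (vee (s :\ i) == vee s) && ra_cond (s :\ i) t =
  ra_cond s t && (vee ((s :|: t) :\ i) == vee (s :|: t)).
Proof.
move=> si; apply/andP/andP => [[/eqP e c]|[c /eqP e]].
  have cst : ra_cond s t by move: c; rewrite /ra_cond !veeU e.
  have ti : i \notin t by rewrite (disjointFr (ra_cond_disjoint cst)).
  by split=> //; rewrite setD1Ul // !veeU e.
have ti : i \notin t by rewrite (disjointFr (ra_cond_disjoint c)).
rewrite setD1Ul // in e; have /eqP c' := c.
have e' : vee (s :\ i) = vee s.
  apply: cd_eq; first exact/vee_sub/subsetDl.
  by have := cdU (s :\ i) t; rewrite e -c' leq_add2r.
by split; rewrite ?e' // /ra_cond !veeU e' -veeU.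
Qed.

Lemma ra_condD1r s t i : i \in t ->
  (vee (t :\ i) == vee t) && ra_cond s (t :\ i) =
  ra_cond s t && (vee ((s :|: t) :\ i) == vee (s :|: t)).
Proof.
rewrite (ra_condC s (t :\ i)) (ra_condC s t) [s :|: t]setUC.
exact: ra_condD1l.
Qed.

Lemma ra_leibniz_basis s t : ra_d (ra_mul_basis s t) =
  ra_mul (ra_d_basis s) (ra_basis t) +
  (-1) ^+ #|s| *: ra_mul (ra_basis s) (ra_d_basis t).
Proof.
have HL : ra_mul (ra_d_basis s) (ra_basis t) =
    \sum_(i in s) if ra_cond s t && (vee ((s :|: t) :\ i) == vee (s :|: t))
      then (- lo s i * sg (s :\ i) t) *: ra_basis ((s :|: t) :\ i) else 0.
  rewrite ra_d_basisE' -[ra_mul _ _]/(ra_mulr _ _) linear_sum big_mkcondr.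
  apply: eq_bigr => i si; rewrite -ra_condD1l //.
  case: (boolP (vee (s :\ i) == vee s)) => //= e.
  rewrite linearZ /= /ra_mulr ra_mul_basisE ra_mul_basisE'.
  case: ifP => c; last by rewrite scaler0.
  rewrite scalerA setD1Ul //.
  have := ra_condD1l t si; rewrite e c => /esym/andP[cst _].
  by rewrite (disjointFr (ra_cond_disjoint cst)).
have HR : ra_mul (ra_basis s) (ra_d_basis t) =
    \sum_(i in t) if ra_cond s t && (vee ((s :|: t) :\ i) == vee (s :|: t))
      then (- lo t i * sg s (t :\ i)) *: ra_basis ((s :|: t) :\ i) else 0.
  rewrite ra_d_basisE' linear_sum big_mkcondr.
  apply: eq_bigr => i ti; rewrite -ra_condD1r //.
  case: (boolP (vee (t :\ i) == vee t)) => //= e.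
  rewrite linearZ /= ra_mul_basisE ra_mul_basisE'.
  case: ifP => c; last by rewrite scaler0.
  rewrite scalerA [s :|: t]setUC setD1Ul 1?setUC //.
  have := ra_condD1r s ti; rewrite e c => /esym/andP[cst _].
  by rewrite (disjointFl (ra_cond_disjoint cst)).
rewrite HL HR ra_mul_basisE'; case: ifP => c /=; last first.
  by rewrite linear0 !big1_eq scaler0 addr0.
have dst := ra_cond_disjoint c.
rewrite linearZ /= ra_d_basisE ra_d_basisE' big_mkcondr.
rewrite (eq_bigl [in [predU s & t]]); last by move=> i; rewrite !inE.
rewrite bigU //= scalerDr !scaler_sumr; congr (_ + _); apply: eq_bigr => i H.
  case: ifP => _; rewrite ?scaler0 // scalerA loU // (sgD1l _ H).
  by congr (_ *: _); have := lo_sqr t i => e; ring: e.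
case: ifP => _; rewrite ?scaler0 // !scalerA loU //.
rewrite (sgD1r H); last by rewrite (disjointFl dst).
by congr (_ *: _); have := lo_sqr s i => e; ring: e.
Qed.

Lemma ra_leibniz k x y : ra_gr k x -> ra_d (ra_mul x y) =
  ra_mul (ra_d x) y + ((-1) ^ k : rat) *: ra_mul x (ra_d y).
Proof.
move=> gx; have := ra_twist_gr gx.
have -> : ra_d (ra_mul x y) = ra_mul (ra_d x) y + ra_mul (ra_twist x) (ra_d y).
  apply: (ra_ext (f := fun x => ra_d (ra_mul x y))
    (g := fun x => ra_mul (ra_d x) y + ra_mul (ra_twist x) (ra_d y))) => [a u v|a u v|s] /=.
  - by rewrite ra_mullP linearP.
  - by rewrite ra_twistP ra_d_linear !ra_mullP scalerDr addrACA.
  apply: (ra_ext (f := fun y => ra_d (ra_mul (ra_basis s) y))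
    (g := fun y => ra_mul (ra_d (ra_basis s)) y + ra_mul (ra_twist (ra_basis s)) (ra_d y))) => [a u v|a u v|t] /=.
  - by rewrite ra_mulrP linearP.
  - by rewrite ra_d_linear !ra_mulrP scalerDr addrACA.
  rewrite ra_twist_basis -[ra_mul (_ *: _) _]/(ra_mulr _ _) linearZ /= /ra_mulr.
  by rewrite !ra_d_basisE ra_mul_basisE ra_leibniz_basis.
move=> ->; congr (_ + _).
by rewrite -[LHS]/(ra_mulr _ _) linearZ.
Qed.

Definition relative_atomic_dga : dga :=
  @DGA ra_space (ra_basis set0) ra_mul ra_d ra_gr ra_mulA ra_mul1 ra_mulr1
    ra_mul_linearl ra_mul_linearr ra_grading ra_gr1 ra_grM ra_d_linear ra_grd
    ra_dd ra_leibniz.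

End RelativeAtomicDGA.

Section Psi.
Variables (K : fieldType) (V : vectType K) (n : nat) (A : arrangement V n).
Local Notation D := (relative_atomic_dga A).

Definition independent (s : {set 'I_n}) : bool :=
  [forall i in s, (vee A (s :\ i) < vee A s)%O].

Lemma independent_cocycle s : independent s -> dga_d (ra_basis s : D) = 0.
Proof.
move=> /forall_inP ind; rewrite /dga_d /= ra_d_basisE.
apply: big1 => i /andP[/ind]; rewrite lt_neqAle => /andP[/eqP ne _] /eqP e.
by case: ne.
Qed.

Definition Psi (x : D) : cohomology_dga D :=
  \sum_(s : {set 'I_n})
    x s *: (if independent s then hclass (ra_basis s : D) else 0).

Lemma Psi_basis s :
  Psi (ra_basis s) = if independent s then hclass (ra_basis s : D) else 0.
Proof. exact: sum_basis. Qed.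

End Psi.
Arguments Psi {K V n} A x.

(* Main.v *)
Require Import Defs.
From mathcomp Require Import all_boot all_order all_algebra.
From mathcomp Require Import reals complex.

Set Implicit Arguments.
Unset Strict Implicit.
Unset Printing Implicit Defensive.

Import Order.TTheory GRing.Theory.
Local Open Scope ring_scope.

(** Psi sends every cocycle to its own class, so that it induces the identity
    on cohomology. To see this, call a set [s] broken at [i] if [i] lies in the
    closure of the elements of [s] that are larger than [i]. The differential
    does not decrease the least element at which a set is broken, and toggling
    that element contracts the associated graded complex; hence every cocycle is
    cohomologous to one supported on sets that are nowhere broken. By the
    exchange property of geometric lattices such sets are independent. *)

Section GeometricArrangement.
Variables (K : fieldType) (V : vectType K) (n : nat) (A : arrangement V n).
Local Notation D := (relative_atomic_dga A).
Local Notation H := (cohomology_dga D).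
Local Notation vee := (vee A).
Implicit Types (s t : {set 'I_n}) (i j k : 'I_n) (x y w : ra_space n).

(** * Closure and independence for sets of atoms *)

Lemma setD1C i j s : s :\ i :\ j = s :\ j :\ i.
Proof. by rewrite setDDl setUC -setDDl. Qed.

Definition in_closure i s : bool := (atom A i <= vee s)%O.

Lemma vee1 i : vee [set i] = atom A i.
Proof. by rewrite veeE. Qed.

Lemma in_closureE i s : in_closure i s = (vee s == vee (i |: s)).
Proof. by rewrite veeU vee1 eq_sym eq_joinr. Qed.

Lemma in_closureS i s t : s \subset t -> in_closure i s -> in_closure i t.
Proof. by move=> /(vee_sub A) st is_; apply: le_trans st. Qed.

Lemma in_closureU1 i j s : in_closure j s -> in_closure i (j |: s) = in_closure i s.
Proof. by rewrite in_closureE /in_closure => /eqP <-. Qed.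

Lemma vee_setD1E i s : i \in s -> (vee (s :\ i) == vee s) = in_closure i (s :\ i).
Proof. by move=> si; rewrite in_closureE setD1K. Qed.

Lemma independentP s :
  reflect (forall i, i \in s -> ~~ in_closure i (s :\ i)) (independent A s).
Proof.
apply: (iffP forall_inP) => ind i si; have := ind i si;
  by rewrite lt_neqAle vee_setD1E // (vee_sub A (subsetDl _ _)) andbT.
Qed.

Lemma independentS s t : s \subset t -> independent A t -> independent A s.
Proof.
move=> st /independentP ind; apply/independentP => i si.
apply: contra (ind i (subsetP st _ si)); apply: in_closureS; exact: setSD.
Qed.

Lemma independent0 : independent A set0.
Proof. by apply/independentP => i; rewrite inE. Qed.

(** When codimensions add up, deleting an element from one factor preserves the join of that factor
    exactly when it preserves the join of the union. This equivalence makes [Psi] multiplicative. *)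
Lemma independentU s t : ra_cond A s t ->
  independent A (s :|: t) = independent A s && independent A t.
Proof.
move=> c; apply/idP/andP => [ind|[/independentP inds /independentP indt]].
  by split; apply: independentS ind; rewrite ?subsetUl ?subsetUr.
apply/independentP => i sti; rewrite -vee_setD1E //; apply/negP => e.
move: sti; rewrite inE => /orP[] i_in.
  by have := ra_condD1l A t i_in; rewrite c e vee_setD1E // (negPf (inds i i_in)).
by have := ra_condD1r A s i_in; rewrite c e vee_setD1E // (negPf (indt i i_in)).
Qed.

(** * The exchange property *)

Section Exchange.
Hypothesis geomL : geometric_lattice (intersection_lattice A).

(** By semimodularity the join of [j |: s] covers that of [s]. The join of [i |: s] lies strictly
    above the latter and below the former, so it equals the former. *)
Lemma in_closure_exchange i j s :
  ~~ in_closure i s -> in_closure i (j |: s) -> in_closure j (i |: s).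
Proof.
move=> nis ijs; have njs : ~~ in_closure j s.
  by apply: contra nis => js; rewrite -(in_closureU1 i js).
have atj : is_atom (atom A j) by apply/is_atomP; exists j.
(* The meet lies strictly below an atom, because [j] is outside the closure of [s]. *)
have meet0 : (atom A j `&` vee s)%O = \bot%O.
  apply/eqP; have /andP[_ /forallP/(_ (atom A j `&` vee s)%O)] := atj.
  rewrite negb_and lt0x negbK => /orP[//|]; rewrite lt_neqAle leIl andbT negbK.
  by rewrite eq_meetl -/(in_closure j s) (negPf njs).
have /geomL.2 : covers (atom A j `&` vee s)%O (atom A j) by rewrite meet0.
have le : (vee (i |: s) <= vee (j |: s))%O.
  by rewrite [vee (i |: s)]veeU vee1 leUx -/(in_closure _ _) ijs vee_sub // subsetUr.
rewrite -vee1 -veeU => /andP[_ /forallP/(_ (vee (i |: s)))].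
rewrite negb_and !lt_neqAle -in_closureE nis (vee_sub A (subsetUr _ _)) le /=.
rewrite andbT negbK => /eqP e.
by rewrite /in_closure e -vee1 vee_sub // subsetUl.
Qed.

(** The terms of the differential of a basis element are therefore all independent or all dependent.
    In matroid terms, if [s :\ i] is independent, then [s] contains a single circuit, and deleting
    any of its elements leaves an independent set. *)
Lemma independent_setD1 i j s : i \in s -> j \in s ->
    in_closure i (s :\ i) -> in_closure j (s :\ j) ->
  independent A (s :\ i) -> independent A (s :\ j).
Proof.
have [->//|ij si sj ci cj /independentP ind] := eqVneq i j.
have nj : ~~ in_closure j (s :\ i :\ j) by apply: ind; rewrite !inE eq_sym ij.
(* Otherwise [i] could be dropped from [s :\ j] without changing its closure, and [j] would
   contradict [nj]. *)
have ni : ~~ in_closure i (s :\ j :\ i).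
  apply: contra nj => ci'; rewrite setD1C.
  by rewrite -(in_closureU1 j ci') setD1K // !inE ij.
apply/independentP => k; rewrite !inE => /andP[kj sk].
have [->//|ki] := eqVneq k i; apply: contra ni => ck.
have nk : ~~ in_closure k (s :\ i :\ j :\ k).
  apply: contra (ind k _); last by rewrite !inE ki.
  by apply: in_closureS; rewrite setSD // subsetDl.
(* Exchanging [k] with [i] over [s :\ i :\ j :\ k] puts [i] in the closure that [ni] excludes. *)
have e : s :\ j :\ k = i |: (s :\ i :\ j :\ k).
  by apply/setP => a; rewrite !inE; have [->|] := eqVneq a i; rewrite ?si ?ij ?(eq_sym i k) ?ki.
rewrite e in ck; have := in_closure_exchange nk ck; congr in_closure.
apply/setP => a; rewrite !inE; have [->|] := eqVneq a k; rewrite ?sk ?kj ?ki //=.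
by rewrite andbCA.
Qed.

End Exchange.

(** * Broken and unbroken sets *)

Definition broken i s : bool := in_closure i [set j in s | (i < j)%N].

(** The element [i] need not belong to [s]. For [m = n] and a geometric lattice these are the sets
    containing no broken circuit, that is, no circuit with its least element removed. *)
Definition unbroken (m : nat) s : bool :=
  [forall i : 'I_n, (i < m)%N ==> ~~ broken i s].

Lemma brokenS i s t : s \subset t -> broken i s -> broken i t.
Proof.
move=> /subsetP st; apply: in_closureS; apply/subsetP => j.
by rewrite !inE => /andP[/st ->].
Qed.

Lemma broken_setD1 i k s : (k <= i)%N -> broken i (s :\ k) = broken i s.
Proof.
move=> ki; congr in_closure; apply/setP => j; rewrite !inE.
by have [->|] := eqVneq j k; rewrite // ltnNge ki !andbF.
Qed.

Lemma broken_in_closure k s : broken k s -> in_closure k (s :\ k).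
Proof.
apply: in_closureS; apply/subsetP => j; rewrite !inE => /andP[->].
by rewrite andbT; apply: contraTneq => ->; rewrite ltnn.
Qed.

Lemma unbrokenS m s t : s \subset t -> unbroken m t -> unbroken m s.
Proof.
move=> st /forallP ut; apply/forallP => i; apply/implyP => im.
by apply: contra (implyP (ut i) im); apply: brokenS.
Qed.

Lemma unbroken0 s : unbroken 0 s.
Proof. by apply/forallP. Qed.

Lemma unbroken_ord k s : unbroken k.+1 s = unbroken k s && ~~ broken k s.
Proof.
apply/forallP/andP => [u|[/forallP u nb] i].
  split; last exact: (implyP (u k)).
  by apply/forallP => i; apply/implyP => ik; apply: (implyP (u i)); apply: ltnW.
apply/implyP; rewrite ltnS leq_eqVlt => /orP[/eqP/val_inj ->//|].
exact: implyP (u i).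
Qed.

(** For [i < k], the elements of [s] above [i] include those above [k], whose closure already
    contains [k]; adjoining [k] does not enlarge their closure. *)
Lemma unbrokenU1 k s : broken k s -> unbroken k s -> unbroken k (k |: s).
Proof.
move=> bk /forallP u; apply/forallP => i; apply/implyP => ik.
apply: contra (implyP (u i) ik); rewrite /broken.
have -> : [set j in k |: s | (i < j)%N] = k |: [set j in s | (i < j)%N].
  by apply/setP => j; rewrite !inE; have [->|] := eqVneq j k; rewrite ?ik.
rewrite in_closureU1 //; apply: in_closureS bk; apply/subsetP => j.
by rewrite !inE => /andP[-> /(ltn_trans ik)].
Qed.

(** A dependent set contains a circuit [t], obtained here as a minimal dependent subset. The least
    element [m] of [t] lies in the closure of the others, so [s] is broken at [m]. *)
Lemma unbroken_independent s :
  geometric_lattice (intersection_lattice A) -> unbroken n s -> independent A s.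
Proof.
move=> geomL /forallP u; apply: contraT => dep.
have [t /minsetP[dept mint] ts] := @minset_exists _ (fun t => ~~ independent A t) s dep.
have ind i : i \in t -> independent A (t :\ i).
  move=> ti; apply: contraT => depi; have := mint _ depi (subsetDl _ _).
  by move/setP/(_ i); rewrite !inE eqxx ti.
have [j tj cj] : exists2 j, j \in t & in_closure j (t :\ j).
  apply/exists_inP; apply: contraNT dept => /exists_inPn nex.
  by apply/independentP.
case: (@arg_minnP _ j (mem t) val tj) => m tm minm.
(* Minimality gives only some [j] in the closure of the rest of [t]; exchange transfers this to
   [m]. *)
have cm : in_closure m (t :\ m).
  have [<-//|jm] := eqVneq j m.
  have -> : t :\ m = j |: (t :\ m :\ j) by rewrite setD1K // !inE jm.
  apply: in_closure_exchange => //.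
    by move/independentP: (ind m tm); apply; rewrite !inE jm.
  by rewrite setD1C setD1K // !inE eq_sym jm.
case/negP: (implyP (u m) (ltn_ord m)); apply: in_closureS cm.
apply/subsetP => a; rewrite !inE => /andP[am ta].
by rewrite (subsetP ts) // ltn_neqAle eq_sym am; apply: minm.
Qed.

(** * Reduction of cocycles to unbroken support *)

Lemma ra_dE x t : ra_d A x t =
  - \sum_(i | (i \notin t) && in_closure i t) lo t i * x (i |: t).
Proof.
rewrite /ra_d sum_ffunE.
transitivity (\sum_(s : {set 'I_n}) \sum_(i in s | in_closure i (s :\ i))
    (if t == s :\ i then - lo s i * x s else 0)).
  apply: eq_bigr => s _; rewrite ra_d_basisE' !ffunE sum_ffunE scaler_sumr.
  rewrite (eq_bigl (fun i => (i \in s) && in_closure i (s :\ i))); last first.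
    by move=> i; have [si|//] := boolP (i \in s); rewrite vee_setD1E.
  apply: eq_bigr => i _; rewrite !ffunE; case: eqP => _ /=.
    by rewrite /GRing.scale /= mulr1 mulrC.
  by rewrite !scaler0.
rewrite (exchange_big_dep predT) //= -sumrN [RHS]big_mkcond; apply: eq_bigr => i _.
rewrite -big_mkcondr /=; case: ifP => [/andP[ti ci]|nti].
  (* Only [s = i |: t] yields [t] on deleting [i], and [lo] takes the same value on both sets since
     [chi i i = 1]. *)
  rewrite (big_pred1 (i |: t)) => [|s].
    by rewrite mulNr /lo big_setU1 //= /chi ltnn expr0 mul1r.
  apply/andP/eqP => [[/andP[si _] /eqP ->]|->]; first by rewrite setD1K.
  by rewrite setU11 setU1K.
rewrite big_pred0 // => s; apply: contraFF nti => /andP[/andP[si ci] /eqP ->].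
by rewrite ci !inE eqxx.
Qed.

Definition supported (P : pred {set 'I_n}) x : Prop := forall s, ~~ P s -> x s = 0.

(** Sets unbroken below [k] and broken at [k] come in pairs [t], [k |: t] with [k] outside [t].
    Subtracting a coboundary clears the coordinates without [k]; the cocycle equation then clears
    those with [k]. *)
Lemma supported_step k x : ra_d A x = 0 -> supported (unbroken k) x ->
  exists w, supported (unbroken k.+1) (x - ra_d A w).
Proof.
move=> dx sx.
(* The value at [k |: t] makes the [k]-term of the differential cancel [x t], as [lo t k] squares to
   1. The condition [unbroken k s] keeps the correction inside the support already reached. *)
pose w : ra_space n := [ffun s : {set 'I_n} =>
  if [&& k \in s, unbroken k s & broken k s] then - lo s k * x (s :\ k) else 0].
exists w; set y := x - ra_d A w.
have dy : ra_d A y = 0 by rewrite /y linearB /= dx ra_dd subrr.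
have yE t : y t = x t + \sum_(i | (i \notin t) && in_closure i t) lo t i * w (i |: t).
  by rewrite !ffunE ra_dE opprK.
have y0 t : ~~ unbroken k t -> y t = 0.
  move=> nu; rewrite yE sx // add0r big1 // => i _; rewrite ffunE.
  by rewrite (contraNF (unbrokenS (subsetUr _ _)) nu) andbF mulr0.
have y1 t : k \notin t -> broken k t -> y t = 0.
  move=> kt bk; have [u|] := boolP (unbroken k t); last exact: y0.
  have ck : in_closure k t by have := broken_in_closure bk; apply: in_closureS; exact: subsetDl.
  (* Terms with [i != k] vanish because [w] is zero on sets without [k]. *)
  rewrite yE (bigD1 k) ?kt //= big1 => [|i /andP[_ ik]]; last first.
    by rewrite ffunE !inE eq_sym (negPf ik) (negPf kt) mulr0.
  rewrite ffunE setU11 unbrokenU1 // (brokenS (subsetUr _ _) bk) /= setU1K //.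
  rewrite /lo big_setU1 //= /chi ltnn expr0 mul1r -/(lo t k) mulrA mulrN.
  by rewrite lo_sqr mulN1r addr0 subrr.
move=> t; rewrite unbroken_ord negb_and negbK => /orP[/y0//|bk].
have [kt|kt] := boolP (k \in t); last exact: y1.
have ck := broken_in_closure bk.
(* In this coordinate of the cocycle equation, every term with [i != k] involves a set without [k]
   that is still broken at [k], so [y1] leaves only [y t] up to sign. *)
move/ffunP/(_ (t :\ k)): dy; rewrite ra_dE ffunE (bigD1 k) ?setD11 ?ck //=.
rewrite setD1K // big1 => [|i /andP[/andP[ti _] ik]]; last first.
  rewrite y1 ?mulr0 // ?inE ?eqxx ?orbF 1?eq_sym //.
  by apply: brokenS (subsetUr _ _) _; rewrite broken_setD1.
move/eqP; rewrite addr0 oppr_eq0 mulf_eq0 => /orP[/eqP lo0|/eqP//].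
by have /eqP := lo_sqr (t :\ k) k; rewrite lo0 mul0r.
Qed.

Lemma cohomologous_unbroken (m : nat) x : (m <= n)%N -> ra_d A x = 0 ->
  exists w, supported (unbroken m) (x - ra_d A w).
Proof.
move=> mn dx; elim: m mn => [|m IH] mn; first by exists 0 => s; rewrite unbroken0.
have [w sw] := IH (ltnW mn).
have [|w' sw'] := @supported_step (Ordinal mn) (x - ra_d A w) _ sw.
  by rewrite linearB /= dx ra_dd subrr.
by exists (w + w'); rewrite linearD /= opprD addrA.
Qed.

(** * [Psi] as a morphism of differential graded algebras *)

Lemma Psi_linear : linear (Psi A).
Proof.
move=> a x y; rewrite /Psi scaler_sumr -big_split; apply: eq_bigr => s _ /=.
by rewrite coordD scalerDl scalerA.
Qed.

Lemma Psi_hclass x : supported (independent A) x -> Psi A x = hclass (x : D).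
Proof.
move=> sx; rewrite [in RHS](ra_coordE x).
have dterm s : s \in index_enum {set 'I_n} -> dga_d (x s *: ra_basis s : D) = 0.
  move=> _; have [ind|/sx ->] := boolP (independent A s).
    exact: dZ0 (independent_cocycle ind).
  by rewrite scale0r linear0.
rewrite (hclass_sum dterm).1 /Psi; apply: eq_bigr => s _.
case: ifPn => [ind|/sx ->]; last by rewrite !scale0r hclass0.
by rewrite hclassZ //; apply: independent_cocycle.
Qed.

Lemma Psi_supportedC x : supported (predC (independent A)) x -> Psi A x = 0.
Proof.
move=> sx; apply: big1 => s _; case: ifPn => [ind|_]; last by rewrite scaler0.
by rewrite sx ?scale0r //= negbK.
Qed.

Lemma ra_d_basis_supp s t : ra_d_basis A s t != 0 ->
  exists i, [/\ i \in s, in_closure i (s :\ i) & t = s :\ i].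
Proof.
have [/exists_inP[i si /andP[ci /eqP ->]] _|/exists_inPn nex] :=
  boolP [exists i in s, in_closure i (s :\ i) && (t == s :\ i)]; first by exists i.
rewrite sum_ffunE big1 ?eqxx // => i /andP[si]; rewrite vee_setD1E // => ci.
by have := nex i si; rewrite ci !ffunE /= => /negPf ->; rewrite scaler0.
Qed.

(** By [independent_setD1] the differential of a basis element has only independent or only
    dependent terms. In the first case its image is the class of a coboundary; in the second every
    term maps to 0. *)
Lemma Psi_d x : geometric_lattice (intersection_lattice A) -> Psi A (ra_d A x) = 0.
Proof.
move=> geomL.
apply: (ra_ext (f := fun x => Psi A (ra_d A x)) (g := fun=> 0)) => [a u v|a u v|s].
- by rewrite ra_d_linear Psi_linear.
- by rewrite scaler0 addr0.
rewrite ra_d_basisE.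
have [/exists_inP[i si /andP[ci ind]]|/exists_inPn nex] :=
  boolP [exists i in s, in_closure i (s :\ i) && independent A (s :\ i)].
  rewrite Psi_hclass => [|t].
    apply/hclass_eq0; first by rewrite -ra_d_basisE; apply: dga_dd.
    by exists (ra_basis s); rewrite -ra_d_basisE.
  apply: contraNeq => /ra_d_basis_supp[j [sj cj ->]].
  exact: independent_setD1 ci cj ind.
apply: Psi_supportedC => t; rewrite /= negbK => indt.
apply/eqP; apply: contraT => /ra_d_basis_supp[i [si ci e]].
by have := nex i si; rewrite ci -e indt.
Qed.

(** If codimensions add, [independentU] matches the two sides. Otherwise the product of the basis
    elements is 0, and hence so is that of their images. *)
Lemma Psi_mul x y : Psi A (ra_mul A x y) = dga_mul (Psi A x) (Psi A y).
Proof.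
apply: (ra_ext (f := fun x => Psi A (ra_mul A x y))
    (g := fun x => dga_mul (Psi A x) (Psi A y))) => [a u v|a u v|s].
- by rewrite ra_mullP Psi_linear.
- by rewrite Psi_linear dga_mullP.
apply: (ra_ext (f := fun y => Psi A (ra_mul A (ra_basis s) y))
    (g := fun y => dga_mul (Psi A (ra_basis s)) (Psi A y))) => [a u v|a u v|t].
- by rewrite ra_mulrP Psi_linear.
- by rewrite Psi_linear dga_mulrP.
rewrite !Psi_basis ra_mul_basisE ra_mul_basisE'.
have l0 : Psi A 0 = 0.
  by have := Psi_linear (-1) 0 0; rewrite !scaleN1r !addNr.
have PsiZ a z : Psi A (a *: z) = a *: Psi A z.
  by have := Psi_linear a z 0; rewrite l0 !addr0.
have mulE (inds : independent A s) (indt : independent A t) :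
    dga_mul (hclass (ra_basis s : D) : H) (hclass (ra_basis t : D)) =
    hclass (ra_mul_basis A s t : D).
  by rewrite -ra_mul_basisE; apply: hmulE; apply: independent_cocycle.
have mul0l (c : H) : @dga_mul H (0 : cohomology D) c = 0 := dga_mul0l c.
have mul0r (c : H) : @dga_mul H c (0 : cohomology D) = 0 := dga_mul0r c.
case: ifP => c; last first.
  rewrite l0; case: ifP => inds; last exact (esym (mul0l _)).
  case: ifP => indt; last exact (esym (mul0r _)).
  by rewrite (mulE inds indt) ra_mul_basisE' c.
rewrite PsiZ Psi_basis (independentU c); case: ifP => [/andP[inds indt]|nst].
  rewrite inds indt (mulE inds indt) ra_mul_basisE' c.
  apply/esym/hclassZ/independent_cocycle.
  by rewrite (independentU c) inds indt.
rewrite scaler0; case: ifP => inds; last exact (esym (mul0l _)).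
case: ifP => indt; last exact (esym (mul0r _)).
by rewrite inds indt in nst.
Qed.

Lemma Psi_gr (m : int) x : ra_gr A m x -> dga_gr m (Psi A x).
Proof.
move=> gx; rewrite /Psi; elim/big_rec: _ => [|s c _ gc]; first exact: gr0.
apply: grD gc; have [->|/gx <-] := eqVneq (x s) 0; first by rewrite scale0r; apply: gr0.
apply: grZ; case: ifP => [ind|_]; last exact: gr0.
by exists (ra_basis s); split; [apply: ra_gr_basis|apply: independent_cocycle|].
Qed.

Lemma Psi_morphism :
  geometric_lattice (intersection_lattice A) -> dga_morphism (Psi A).
Proof.
move=> geomL; split; [exact: Psi_linear| |exact: Psi_mul|exact: Psi_gr|].
  by rewrite Psi_basis independent0.
by move=> x; apply: Psi_d.
Qed.

(** * The map induced on cohomology *)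

Lemma Psi_cocycle x : geometric_lattice (intersection_lattice A) ->
  ra_d A x = 0 -> Psi A x = hclass (x : D).
Proof.
(* Replacing [x] by [x - ra_d A w] changes neither its class nor its image, and the new support is
   independent. *)
move=> geomL dx; have [w sw] := cohomologous_unbroken (leqnn n) dx.
have e : 1 *: ra_d A w + (x - ra_d A w) = x by rewrite scale1r addrC subrK.
have dxw : ra_d A (x - ra_d A w) = 0 by rewrite linearB /= dx ra_dd subrr.
have := Psi_linear 1 (ra_d A w) (x - ra_d A w).
rewrite e (Psi_d _ geomL) scaler0 add0r => ->.
rewrite Psi_hclass => [|s]; last first.
  by move=> dep; apply: sw; apply: contra dep; apply: unbroken_independent.
by apply/esym/(@hclass_eq D _ _ w dxw); rewrite -[LHS]e scale1r addrC.
Qed.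

Lemma Psi_quasi_isomorphism :
  geometric_lattice (intersection_lattice A) -> quasi_isomorphism (Psi A).
Proof.
move=> geomL; have morP := Psi_morphism geomL; split=> //.
have mapE c : cohomology_map (Psi A) c = hclass (c : H).
  elim/hclassW: c => x dx.
  by rewrite cohomology_mapE // Psi_cocycle.
(* The differential of [H] is zero, so each class of [H] has exactly one representative and [hrepr]
   inverts [hclass]. *)
exists (@hrepr H) => c; rewrite mapE; last exact: hreprK.
by have [|w ->] := @hrepr_hclass H c; rewrite ?addr0.
Qed.

End GeometricArrangement.

Lemma formal_quasi_isomorphism (E : dga) (f : E -> cohomology_dga E) :
  quasi_isomorphism f -> formal E.
Proof.
move=> qf; exists 1%N, (fun m => if m is 0 then E else cohomology_dga E).
by split=> // -[|//] _; left; exists f.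
Qed.

Theorem theorem3p1 (R : realType) (V : vectType R[i]) (n : nat)
    (A : arrangement V n)
    (geomL : geometric_lattice (intersection_lattice A)) :
  quasi_isomorphism (Psi A) /\ formal (relative_atomic_dga A).
Proof.
have qiso := Psi_quasi_isomorphism geomL.
by split=> //; apply: formal_quasi_isomorphism qiso.
Qed.
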